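(* Let $p$ be a prime of the form $p=4k+1$. If there exist positive integers $d,u,v$ such that $(du,dv,duv)$ is a solution for $p$, i.e. $\frac{4}{p}=\frac{1}{du}+\frac{1}{dv}+\frac{1}{duv}$, then this solution is of Type II.
   Context: For a positive integer $a$, a solution for $a$ is a triple of positive integers $(x,y,z)$ with $\frac{4}{a}=\frac1x+\frac1y+\frac1z$. A solution is of Type II if, after arranging its entries in nondecreasing order $x\le y\le z$, one has $\gcd(a,x)=1$ and $\gcd(a,y)=\gcd(a,z)=a$ (i.e. $a\mid y$ and $a\mid z$). *)

(* Defs.v *)
From mathcomp Require Import all_boot all_order all_algebra.

Set Implicit Arguments.
Unset Strict Implicit.
Unset Printing Implicit Defensive.

Import Order.TTheory GRing.Theory Num.Theory.

Definition is_solution (a : nat) (t : nat * nat * nat) : Prop :=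
  let: (x, y, z) := t in
  [/\ (0 < x)%N, (0 < y)%N, (0 < z)%N
    & (4%:R / a%:R = x%:R^-1 + y%:R^-1 + z%:R^-1 :> rat)%R].

Definition is_typeII (a : nat) (t : nat * nat * nat) : Prop :=
  let: (x, y, z) := t in
  let s := sort leq [:: x; y; z] in
  [/\ is_solution a t,
      gcdn a (nth 0 s 0) = 1,
      gcdn a (nth 0 s 1) = a
    & gcdn a (nth 0 s 2) = a].

(* Main.v *)
Require Import Defs.
From mathcomp Require Import all_boot all_order all_algebra.
From mathcomp Require Import zify ring.
Import GRing.Theory Num.Theory.

(** Clearing denominators gives [4duv = p(u + v + 1)]; by symmetry take [u <= v].
    If [p] divided [d] or [u], one side would be too large for equality to hold,
    so [p] divides [v] only, hence the two larger entries [dv] and [duv]. *)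

Lemma is_solution_clear_denominators (p d u v : nat) :
  0 < p -> is_solution p (d * u, d * v, d * u * v) ->
  4 * (d * u * v) = p * (u + v + 1).
Proof.
move=> p_gt0 [du_gt0 dv_gt0 _ eq_sol].
have d_gt0 : 0 < d by lia.
have u_gt0 : 0 < u by lia.
have v_gt0 : 0 < v by lia.
have nz (n : nat) : 0 < n -> (n%:R != 0 :> rat)%R by rewrite pnatr_eq0 lt0n.
have := nz p p_gt0; have := nz d d_gt0; have := nz u u_gt0; have := nz v v_gt0.
move=> v0 u0 d0 p0; apply/eqP; rewrite -(eqr_nat rat); apply/eqP.
(* The given equation is multiplied by [p * d * u * v], which exposes [4 / p] for replacement by the
   sum of reciprocals. *)
have -> : ((4 * (d * u * v))%:R
           = 4%:R / p%:R * (p%:R * d%:R * u%:R * v%:R) :> rat)%R.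
  by rewrite !natrM; field.
by rewrite eq_sol !natrM !natrD; field; apply/and3P.
Qed.

Lemma eqn_prime_dvd (p d u v : nat) : prime p -> odd p ->
  0 < d -> 0 < u -> u <= v -> 4 * (d * u * v) = p * (u + v + 1) ->
  [/\ ~~ (p %| d), ~~ (p %| u) & p %| v].
Proof.
move=> p_prime p_odd d_gt0 u_gt0 le_uv E; have p_gt1 := prime_gt1 p_prime.
have p_gt0 := prime_gt0 p_prime.
have pNd : ~~ (p %| d).
  apply/negP => /dvdnP[e de]; move: E; rewrite {}de in d_gt0 *.
  rewrite (_ : 4 * _ = p * (4 * (e * (u * v)))); last by lia.
  move/eqP; rewrite eqn_pmul2l // => /eqP E.
  have e_gt0 : 0 < e by lia.
  have : u * v <= e * (u * v) by rewrite leq_pmull.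
  (* Contradiction: [u + v + 1 < 4 * (u * v) <= 4 * (e * (u * v))], as [u] and [v] are positive. *)
  by nia.
have pNu : ~~ (p %| u).
  apply/negP => /dvdnP[m ue]; move: E.
  (* Only the [u] on the left is expanded: after cancelling [p], the right side keeps the bound
     [u + v + 1 <= 2 * v + 1 < 4 * v], from [u <= v]. *)
  rewrite {1}ue (_ : 4 * _ = p * (4 * (d * (m * v)))); last by lia.
  move/eqP; rewrite eqn_pmul2l // => /eqP E.
  have m_gt0 : 0 < m by lia.
  have : v <= d * (m * v) by rewrite mulnA leq_pmull // muln_gt0 d_gt0.
  by nia.
split=> //.
have : p %| 4 * (d * u * v) by rewrite E dvdn_mulr.
rewrite !Euclid_dvdM // (negPf pNd) (negPf pNu) /= => /orP[p4|//].
have /eqP p2 : p == 2.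
  by move: p4; rewrite (_ : 4 = 2 * 2) // Euclid_dvdM // orbb dvdn_prime2.
by rewrite p2 in p_odd.
Qed.

Lemma is_solution_swap (a x y z : nat) :
  is_solution a (x, y, z) -> is_solution a (y, x, z).
Proof. by case=> x_gt0 y_gt0 z_gt0 E; split=> //; rewrite [(y%:R^-1 + _)%R]addrC. Qed.

(** The gcd conditions see only the sorted triple, which is invariant under permutation; this
    supports the reduction to [u <= v]. *)
Lemma is_typeII_swap (a x y z : nat) :
  is_typeII a (x, y, z) -> is_typeII a (y, x, z).
Proof.
rewrite /is_typeII.
have -> : sort leq [:: y; x; z] = sort leq [:: x; y; z].
  apply/perm_sortP; [exact: leq_total|exact: leq_trans|exact: anti_leq|].
  by rewrite (perm_catCA [:: y] [:: x] [:: z]).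
by case=> sol g0 g1 g2; split=> //; apply: is_solution_swap.
Qed.

Theorem theorem2 (p k : nat) (p_prime : prime p) (pE : p = 4 * k + 1)
  (d u v : nat) (d_gt0 : 0 < d) (u_gt0 : 0 < u) (v_gt0 : 0 < v) :
  is_solution p (d * u, d * v, d * u * v) ->
  is_typeII p (d * u, d * v, d * u * v).
Proof.
wlog le_uv : u v u_gt0 v_gt0 / u <= v => [IH sol|sol].
  have [/IH|/ltnW le_vu] := leqP u v; first exact.
  apply: is_typeII_swap; rewrite mulnAC; apply: IH => //.
  by rewrite mulnAC; apply: is_solution_swap.
have p_odd : odd p by rewrite pE; lia.
have E := is_solution_clear_denominators _ _ _ _ (prime_gt0 p_prime) sol.
have [pNd pNu pv] := eqn_prime_dvd _ _ _ _ p_prime p_odd d_gt0 u_gt0 le_uv E.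
(* With [u <= v] and [1 <= u] the triple is already in order, so sorting leaves it unchanged. *)
have s_sorted : sorted leq [:: d * u; d * v; d * u * v].
  by rewrite /= leq_mul2l le_uv orbT /= andbT mulnAC leq_pmulr.
rewrite /is_typeII (sorted_sort leq_trans s_sorted) /=; split=> //.
- by apply/eqP; rewrite -/(coprime _ _) prime_coprime // Euclid_dvdM // negb_or pNd.
- by apply/gcdn_idPl; rewrite dvdn_mull.
- by apply/gcdn_idPl; rewrite dvdn_mull.
Qed.
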